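(* Let $n\ge 1$, let $m_1,\dots,m_n>0$, and let $\mathcal{M}$ be the space of $n$-gons in the Minkowski space $\mathbb{M}^3$ with time-like sides $p_\alpha$ of lengths $m_\alpha$, modulo the adjoint action of $SL_2(\mathbb{R})$, restricted to its non-collinear locus $\mathcal{M}^*$. Then the almost complex structure $I$ on $\mathcal{M}^*$, given on the tangent space $\mathcal{T}(P)$ at $P=\{p_\alpha\}$ (whose elements are represented by tuples $\{q_\alpha\}$ satisfying $\sum_\alpha [q_\alpha,p_\alpha]/m_\alpha=0$) by $$I\{q_\alpha\}=\Big\{\tfrac{[q_\alpha,p_\alpha]}{m_\alpha}\Big\},$$ is integrable.
   Context: Minkowski space $\mathbb{M}^3$ is $\mathbb{R}^3$ with the form $(u,v)=u_3v_3-u_1v_1-u_2v_2$ and the bracket $[u,v]=J(u\times v)$, where $\times$ is the usual vector product and $J=\mathrm{diag}(-1,-1,1)$. The bracket satisfies: $[u,v]=-[v,u]$; $[u,v]$ is orthogonal to $u$ and $v$; $([u,v],w)=(u,[v,w])$; $[u,[v,w]]=(u,w)v-(u,v)w$. Identify $\mathbb{M}^3$ with $\mathfrak{sl}_2(\mathbb{R})$, with form $(A,B)=-\frac12\mathrm{tr}(AB)$, by the isometry $f(x,y,z)=\begin{pmatrix} x & y+z \\ y-z & -x \end{pmatrix}$, and transport the bracket: $[A,B]:=f[f^{-1}A,f^{-1}B]$. Then $SL_2(\mathbb{R})$ acts on $\mathbb{M}^3$ by the adjoint action (conjugation). Polygons: $\widetilde{\mathcal{M}}$ is the set of tuples $P=(p_1,\dots,p_n)\in(\mathbb{M}^3)^n$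 with $\sum_\alpha p_\alpha=0$ and $(p_\alpha,p_\alpha)=m_\alpha^2$ for all $\alpha$; $\mathcal{M}=\widetilde{\mathcal{M}}/SL_2(\mathbb{R})$ (diagonal adjoint action). $\widetilde{\mathcal{M}}^*\subset\widetilde{\mathcal{M}}$ and $\mathcal{M}^*=\widetilde{\mathcal{M}}^*/SL_2(\mathbb{R})$ denote the open loci where $p_1,\dots,p_n$ are not all multiples of one vector; $\mathcal{M}^*$ is a smooth manifold. Tangent space: the tangent space $\mathcal{T}(P)$ of $\mathcal{M}^*$ at the class of $P$ is the space of tuples $q=\{q_\alpha\}\in(\mathbb{M}^3)^n$ with $(q_\alpha,p_\alpha)=0$ for all $\alpha$ and $\sum_\alpha q_\alpha=0$, where $\{q_\alpha\}$ and $\{w_\alpha\}$ are identified if there is $x\in\mathbb{M}^3$ with $w_\alpha=q_\alpha+[x,p_\alpha]$ for all $\alpha$. Each class has a unique representative satisfying the calibration condition $\sum_\alpha [q_\alpha,p_\alpha]/m_\alpha=0$, and $I$ is defined on these representatives; $I^2=-1$. Integrable means that $I$ is induced by a complex manifold structure on $\mathcal{M}^*$, equivalently that its Nijenhuis tensor vanishes. *)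

(* Defs.v *)
From HB Require Import structures.
From mathcomp Require Import all_boot all_order all_algebra.
From mathcomp Require Import all_classical all_reals all_analysis.
From mathcomp Require Import ring lra.
Set Implicit Arguments.
Unset Strict Implicit.
Unset Printing Implicit Defensive.
Import Order.TTheory GRing.Theory Num.Theory numFieldNormedType.Exports.
Local Open Scope classical_set_scope.
Local Open Scope ring_scope.

Section Minkowski.
Context {R : realType}.
Implicit Types u v w x p : 'rV[R]_3.

Definition i0 : 'I_3 := @Ordinal 3 0 isT.
Definition i1 : 'I_3 := @Ordinal 3 1 isT.
Definition i2 : 'I_3 := @Ordinal 3 2 isT.

Definition vec3 (a b c : R) : 'rV[R]_3 :=
  \row_(j < 3) (if j == i0 then a else if j == i1 then b else c).

Definition mform u v : R :=
  u ord0 i2 * v ord0 i2 - u ord0 i0 * v ord0 i0 - u ord0 i1 * v ord0 i1.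

Definition crossprod u v : 'rV[R]_3 :=
  vec3 (u ord0 i1 * v ord0 i2 - u ord0 i2 * v ord0 i1)
       (u ord0 i2 * v ord0 i0 - u ord0 i0 * v ord0 i2)
       (u ord0 i0 * v ord0 i1 - u ord0 i1 * v ord0 i0).

Definition Jmx : 'M[R]_3 := diag_mx (vec3 (-1) (-1) 1).

(* Vectors are rows; J is symmetric, so J w is written w *m J. *)
Definition bracket u v : 'rV[R]_3 := crossprod u v *m Jmx.

Definition to_sl2 u : 'M[R]_2 :=
  \matrix_(i < 2, j < 2)
    if i == ord0 then (if j == ord0 then u ord0 i0 else u ord0 i1 + u ord0 i2)
    else (if j == ord0 then u ord0 i1 - u ord0 i2 else - u ord0 i0).

(* Inverse of to_sl2 on traceless matrices, see to_sl2K and of_sl2K. *)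
Definition of_sl2 (A : 'M[R]_2) : 'rV[R]_3 :=
  vec3 (A ord0 ord0)
       ((A ord0 ord_max + A ord_max ord0) / 2)
       ((A ord0 ord_max - A ord_max ord0) / 2).

Lemma to_sl2K : cancel to_sl2 of_sl2.
Proof.
move=> u; apply/rowP => j; rewrite !mxE /=.
case: j => [[|[|[|//]]] hj] /=.
- by congr (u _ _); apply/val_inj.
- rewrite (_ : Ordinal hj = i1); last exact/val_inj.
  by field.
- rewrite (_ : Ordinal hj = i2); last exact/val_inj.
  by field.
Qed.

Lemma of_sl2K (A : 'M[R]_2) : \tr A = 0 -> to_sl2 (of_sl2 A) = A.
Proof.
rewrite /mxtrace big_ord_recl big_ord1 => trA.
have {}trA : A (lift ord0 ord0) (lift ord0 ord0) = - A ord0 ord0.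
  by apply/eqP; rewrite -addr_eq0 addrC trA.
have e1 : ord_max = lift ord0 ord0 :> 'I_2 by apply/val_inj.
apply/matrixP => i j; rewrite !mxE /=.
case: (unliftP ord0 i) => [i'|] ->; case: (unliftP ord0 j) => [j'|] ->;
  rewrite ?(ord1 i') ?(ord1 j') /= ?e1 ?trA //; by field.
Qed.

Lemma to_sl2_isometry u v :
  mform u v = - (1 / 2) * \tr (to_sl2 u *m to_sl2 v).
Proof.
rewrite /mxtrace !big_ord_recl big_ord0 !mxE !big_ord_recl !big_ord0 !mxE /=.
by rewrite /mform; field.
Qed.

Lemma bracketE u v : bracket u v =
  vec3 (u ord0 i2 * v ord0 i1 - u ord0 i1 * v ord0 i2)
       (u ord0 i0 * v ord0 i2 - u ord0 i2 * v ord0 i0)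
       (u ord0 i0 * v ord0 i1 - u ord0 i1 * v ord0 i0).
Proof.
apply/rowP => j; rewrite /bracket /Jmx mul_mx_diag !mxE.
by case: (j == i0); case: (j == i1); rewrite ?mulrN1 ?mulr1 ?opprB.
Qed.

Lemma row3P u v : u ord0 i0 = v ord0 i0 -> u ord0 i1 = v ord0 i1 ->
  u ord0 i2 = v ord0 i2 -> u = v.
Proof.
move=> h0 h1 h2; apply/rowP => -[[|[|[|//]]] hj].
- by rewrite (_ : Ordinal hj = i0) //; exact/val_inj.
- by rewrite (_ : Ordinal hj = i1) //; exact/val_inj.
- by rewrite (_ : Ordinal hj = i2) //; exact/val_inj.
Qed.

Lemma bracketDl u v p : bracket (u + v) p = bracket u p + bracket v p.
Proof. by rewrite !bracketE; apply: row3P; rewrite !mxE /=; ring. Qed.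

Lemma bracketZl k u p : bracket (k *: u) p = k *: bracket u p.
Proof. by rewrite !bracketE; apply: row3P; rewrite !mxE /=; ring. Qed.

Lemma bracketA u v w :
  bracket u (bracket v w) = mform u w *: v - mform u v *: w.
Proof. by rewrite !bracketE /mform; apply: row3P; rewrite !mxE /=; ring. Qed.

Lemma bracketC u v : bracket u v = - bracket v u.
Proof. by rewrite !bracketE; apply: row3P; rewrite !mxE /=; ring. Qed.

Lemma mformZl k u v : mform (k *: u) v = k * mform u v.
Proof. by rewrite /mform !mxE; ring. Qed.

Lemma mformC u v : mform u v = mform v u.
Proof. by rewrite /mform; ring. Qed.

Lemma mform_bracket_bracket x p :
  mform (bracket (bracket x p) p) x = - mform (bracket x p) (bracket x p).
Proof. by rewrite !bracketE /mform !mxE /=; ring. Qed.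

Lemma mform_bracketl u p : mform (bracket u p) p = 0.
Proof. by rewrite !bracketE /mform !mxE /=; ring. Qed.

Lemma timelike_orthogonal w p : 0 < mform p p -> mform w p = 0 ->
  mform w w <= 0 /\ (mform w w = 0 -> w = 0).
Proof.
move=> pp wp; pose s := w ord0 i0 ^+ 2 + w ord0 i1 ^+ 2.
have p2 : 0 < p ord0 i2 ^+ 2.
  by move: pp; rewrite /mform; move: (sqr_ge0 (p ord0 i0)) (sqr_ge0 (p ord0 i1)); nra.
have key : p ord0 i2 ^+ 2 * mform w w <= - (mform p p * s).
  have wpE : w ord0 i2 * p ord0 i2 = w ord0 i0 * p ord0 i0 + w ord0 i1 * p ord0 i1.
    by move: wp; rewrite /mform; lra.
  rewrite -subr_ge0 (_ : _ - _ = (w ord0 i0 * p ord0 i1 - w ord0 i1 * p ord0 i0) ^+ 2).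
    exact: sqr_ge0.
  by rewrite /mform /s; ring: wpE.
have s0 : 0 <= s by rewrite /s addr_ge0 ?sqr_ge0.
split.
  by rewrite -(pmulr_rle0 _ p2) (le_trans key) // oppr_le0 mulr_ge0 // ltW.
move=> ww; move: key; rewrite ww mulr0 oppr_ge0 pmulr_rle0 // => s_le0.
have {s_le0 s0} : s == 0 by rewrite eq_le s_le0 s0.
rewrite /s paddr_eq0 ?sqr_ge0 // !sqrf_eq0 => /andP[/eqP w0 /eqP w1].
move: ww; rewrite /mform w0 w1 !mulr0 !subr0 => /eqP; rewrite mulf_eq0 orbb => /eqP w2.
by apply: row3P; rewrite !mxE.
Qed.

Lemma bracket_eq0 x p : x != 0 -> bracket x p = 0 -> exists c, p = c *: x.
Proof.
move=> x0; rewrite bracketE => /rowP h.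
move: (h i0) (h i1) (h i2); rewrite !mxE /= => h0 h1 h2.
have [e|n0] := eqVneq (x ord0 i0) 0; last first.
  exists (p ord0 i0 / x ord0 i0); apply: row3P; rewrite !mxE;
  apply: (mulfI n0); rewrite mulrA [X in _ = X * _]mulrC divfK //; lra.
have [e1|n1] := eqVneq (x ord0 i1) 0; last first.
  exists (p ord0 i1 / x ord0 i1); apply: row3P; rewrite !mxE;
  apply: (mulfI n1); rewrite mulrA [X in _ = X * _]mulrC divfK //; lra.
have [e2|n2] := eqVneq (x ord0 i2) 0; last first.
  exists (p ord0 i2 / x ord0 i2); apply: row3P; rewrite !mxE;
  apply: (mulfI n2); rewrite mulrA [X in _ = X * _]mulrC divfK //; lra.
by case/eqP: x0; apply: row3P; rewrite !mxE.
Qed.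

Definition SL2 : set 'M[R]_2 := [set g | \det g = 1].

Definition Ad (g : 'M[R]_2) u : 'rV[R]_3 :=
  of_sl2 (g *m to_sl2 u *m invmx g).

End Minkowski.

Section Polygons.
Context {R : realType} {n : nat}.
Context (m : 'I_n -> R).
(* An n-tuple of vectors of M^3 is the n x 3 matrix of its rows, so that the
   library's topology and differential on matrices apply. *)
Implicit Types P q w : 'M[R]_(n, 3).

Definition polygon P : Prop :=
  \sum_a row a P = 0 /\ forall a, mform (row a P) (row a P) = m a ^+ 2.

Definition collinear P : Prop :=
  exists v : 'rV[R]_3, forall a, exists c : R, row a P = c *: v.

Definition Mstar : set 'M[R]_(n, 3) := [set P | polygon P /\ ~ collinear P].

Definition SL2act (g : 'M[R]_2) P : 'M[R]_(n, 3) :=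
  \matrix_(a < n) Ad g (row a P).

Definition tangent P q : Prop :=
  (forall a, mform (row a q) (row a P) = 0) /\ \sum_a row a q = 0.

(* Equality in T(P), i.e. modulo the tangent space of the SL2-orbit. *)
Definition same_class P q w : Prop :=
  exists x : 'rV[R]_3, forall a, row a w = row a q + bracket x (row a P).

Definition calibrated P q : Prop :=
  \sum_a (m a)^-1 *: bracket (row a q) (row a P) = 0.

(* The calibrated representative of the class of q; it exists and is unique
   by calibrated_exists and calibrated_unique. *)
Definition calibrate P q : 'M[R]_(n, 3) :=
  xget 0 [set w | same_class P q w /\ calibrated P w].

Definition Iformula P q : 'M[R]_(n, 3) :=
  \matrix_(a < n) ((m a)^-1 *: bracket (row a q) (row a P)).

Context (m_gt0 : forall a, 0 < m a).

Let cal_mx P : 'M[R]_3 :=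
  \sum_a (m a)^-1 *:
    \matrix_(i < 3) bracket (bracket (delta_mx ord0 i) (row a P)) (row a P).

Let mul_cal_mx P x :
  x *m cal_mx P = \sum_a (m a)^-1 *: bracket (bracket x (row a P)) (row a P).
Proof.
have e1 : lift ord0 ord0 = i1 by apply/val_inj.
have e2 : lift ord0 (lift ord0 ord0) = i2 by apply/val_inj.
have e0 : ord0 = i0 by apply/val_inj.
rewrite /cal_mx mulmx_sumr; apply: eq_bigr => a _; rewrite -scalemxAr.
congr (_ *: _); rewrite !bracketE; apply: row3P;
rewrite !mxE !big_ord_recl big_ord0 !(bracketE, mxE) /= ?e1 ?e2 ?e0; ring.
Qed.

Let cal_mx_unit P : polygon P -> ~ collinear P -> cal_mx P \in unitmx.
Proof.
move=> [_ Pm] ncol; rewrite -row_free_unit -kermx_eq0; apply/rowV0P => x.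
move=> /sub_kermxP; rewrite mul_cal_mx => x0; apply/eqP/negPn/negP => xn0.
apply: ncol; exists x => a.
have pp b : 0 < mform (row b P) (row b P) by rewrite Pm exprn_gt0.
have tl b := timelike_orthogonal (pp b) (mform_bracketl x (row b P)).
have : \sum_b (m b)^-1 * - mform (bracket x (row b P)) (bracket x (row b P)) = 0.
  transitivity (mform (\sum_b (m b)^-1 *: bracket (bracket x (row b P)) (row b P)) x).
    elim/big_rec2: _ => [|b u v _ ->]; first by rewrite /mform !mxE !mul0r !subr0.
    by rewrite -mform_bracket_bracket /mform !mxE; ring.
  by rewrite x0 /mform !mxE !mul0r !subr0.
move=> /eqP; rewrite psumr_eq0; last first.
  by move=> b _; rewrite mulr_ge0 ?invr_ge0 ?oppr_ge0 ?(ltW (m_gt0 b)) //; case: (tl b).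
move=> /allP /(_ a (mem_index_enum _)) /=.
rewrite mulf_eq0 invr_eq0 gt_eqF //= oppr_eq0 => /eqP /(tl a).2.
exact: bracket_eq0.
Qed.

Lemma calibrated_exists P q : Mstar P ->
  exists w, same_class P q w /\ calibrated P w.
Proof.
move=> [Pp Pc]; have U := cal_mx_unit Pp Pc.
pose b := \sum_a (m a)^-1 *: bracket (row a q) (row a P).
pose x := - b *m invmx (cal_mx P).
exists (\matrix_a (row a q + bracket x (row a P))); split.
  by exists x => a; rewrite rowK.
rewrite /calibrated; under eq_bigr => a _ do
  rewrite rowK (bracketDl (row a q)) scalerDr.
by rewrite big_split /= -mul_cal_mx mulmxKV // subrr.
Qed.

Lemma calibrated_unique P q w w' : Mstar P ->
  same_class P q w -> calibrated P w ->
  same_class P q w' -> calibrated P w' -> w = w'.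
Proof.
move=> [Pp Pc] [x wx] cw [x' wx'] cw'; have U := cal_mx_unit Pp Pc.
suff xx : x = x' by apply/row_matrixP => a; rewrite wx wx' xx.
apply: (can_inj (mulmxK U)); rewrite !mul_cal_mx.
pose b := \sum_a (m a)^-1 *: bracket (row a q) (row a P).
apply: (addrI b); rewrite /b -!big_split /=.
transitivity (0 : 'rV[R]_3).
  rewrite -[RHS]cw; apply: eq_bigr => a _.
  by rewrite wx bracketDl scalerDr.
rewrite -[LHS]cw'; apply: eq_bigr => a _.
by rewrite wx' bracketDl scalerDr.
Qed.

(* The almost complex structure on T(P), on an arbitrary representative. *)
Definition Istruct P q : 'M[R]_(n, 3) := Iformula P (calibrate P q).

Lemma calibrate_id P q : Mstar P -> calibrated P q -> calibrate P q = q.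
Proof.
move=> MP cq; apply: xget_unique.
  by split=> //; exists 0 => a; rewrite bracketE; apply: row3P;
    rewrite !mxE /= !mul0r subrr addr0.
by move=> w [qw cw]; apply: (calibrated_unique MP qw cw) => //;
  exists 0 => a; rewrite bracketE; apply: row3P; rewrite !mxE /= !mul0r subrr addr0.
Qed.

Lemma IformulaK P q : Mstar P -> tangent P q ->
  Iformula P (Iformula P q) = - q.
Proof.
move=> [[_ Pm] _] [qP _]; apply/row_matrixP => a.
rewrite !rowK bracketZl bracketC bracketA mformC qP scale0r subr0 Pm.
rewrite !scalerN !scalerA -invfM -expr2 mulVf ?expf_neq0 ?gt_eqF //.
by rewrite scale1r; apply/rowP => j; rewrite !mxE.
Qed.

Lemma Iformula_tangent P q : Mstar P -> tangent P q -> calibrated P q ->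
  tangent P (Iformula P q) /\ calibrated P (Iformula P q).
Proof.
move=> MP Tq cq; split; first split.
- by move=> a; rewrite rowK mformZl mform_bracketl mulr0.
- by rewrite -[RHS]cq; apply: eq_bigr => a _; rewrite rowK.
- rewrite /calibrated; transitivity (\sum_a row a (Iformula P (Iformula P q))).
    by apply: eq_bigr => a _; rewrite [RHS]rowK.
  rewrite IformulaK //; under eq_bigr => a _ do rewrite linearN.
  by rewrite sumrN Tq.2 oppr0.
Qed.

End Polygons.

Section VectorFields.
Context {R : realType}.

Fixpoint Ck_on (V W : normedModType R) (k : nat) (U : set V) (f : V -> W) :
    Prop :=
  match k with
  | 0%N => forall x, U x -> {for x, continuous f}
  | k'.+1 => (forall x, U x -> differentiable f x) /\
             forall v : V, Ck_on k' U (fun x => 'd f x v)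
  end.

Definition smooth_on (V W : normedModType R) (U : set V) (f : V -> W) : Prop :=
  forall k, Ck_on k U f.

Context {n : nat}.
Context (m : 'I_n -> R).
Implicit Types (P : 'M[R]_(n, 3)) (X Y : 'M[R]_(n, 3) -> 'M[R]_(n, 3)).

(* An open subset of the quotient Mstar / SL2 is an SL2-stable set of the form
   U `&` Mstar with U open in the space of tuples. A smooth vector field on it
   is given by its calibrated representatives: an SL2-equivariant family of
   calibrated tangent tuples on U `&` Mstar, smooth in the sense that it
   extends smoothly to U. The values of X outside Mstar are irrelevant. *)
Definition SL2_stable (S : set 'M[R]_(n, 3)) : Prop :=
  forall g P, SL2 g -> S P -> S (SL2act g P).

Definition quotient_open (U : set 'M[R]_(n, 3)) : Prop :=
  open U /\ SL2_stable (U `&` Mstar m).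

Definition vector_field (U : set 'M[R]_(n, 3)) X : Prop :=
  smooth_on U X /\
  forall P, (U `&` Mstar m) P ->
    [/\ tangent P (X P), calibrated m P (X P) &
        forall g, SL2 g -> X (SL2act g P) = SL2act g (X P)].

(* For X, Y as in vector_field, this is tangent to Mstar at P in Mstar, does
   not depend on the extensions of X and Y, and, as the lift of a bracket is
   the bracket of the lifts, its class in T(P) is the value at the class of P
   of the Lie bracket on Mstar / SL2. It need not be calibrated. *)
Definition lie X Y P : 'M[R]_(n, 3) := 'd Y P (X P) - 'd X P (Y P).

(* I applied to a vector field; as X P is calibrated, this is Istruct m P (X P)
   by calibrate_id, in a form that is smooth off Mstar as well. *)
Definition Ifield X P : 'M[R]_(n, 3) := Iformula m P (X P).

(* N(X, Y) = [IX, IY] - I[IX, Y] - I[X, IY] - [X, Y] *)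
Definition nijenhuis X Y P : 'M[R]_(n, 3) :=
  lie (Ifield X) (Ifield Y) P
  - Istruct m P (lie (Ifield X) Y P)
  - Istruct m P (lie X (Ifield Y) P)
  - lie X Y P.

(* The Nijenhuis tensor of I vanishes as an element of T(P). *)
Definition I_integrable : Prop :=
  forall (U : set 'M[R]_(n, 3)) X Y,
    quotient_open U -> vector_field U X -> vector_field U Y ->
    forall P, (U `&` Mstar m) P -> same_class P (nijenhuis X Y P) 0.

End VectorFields.

(* Main.v *)
Require Import Defs.
From mathcomp Require Import all_boot all_order all_algebra.
From mathcomp Require Import all_classical all_reals all_analysis.
From mathcomp Require Import ring.
Import Order.TTheory GRing.Theory Num.Theory numFieldNormedType.Exports.
Set Implicit Arguments.
Unset Strict Implicit.
Unset Printing Implicit Defensive.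
Local Open Scope classical_set_scope.
Local Open Scope ring_scope.

(* Write J for the map {q_a} |-> {[q_a, p_a] / m_a}. The identities
   (X_a, p_a) = 0, sum_a X_a = 0 and sum_a [X_a, p_a] / m_a = 0 hold for a vector
   field X along the manifold of polygons, so they may be differentiated in any
   tangent direction. The first one and a computation side by side give
     J([IX, Y] + [X, IY]) = [IX, IY] - [X, Y]
   as tuples; the other two show that the sum of the right-hand side vanishes,
   i.e. that [IX, Y] + [X, IY] is calibrated although its two terms need not be.
   As calibration is linear, the Nijenhuis tensor vanishes already as a tuple.

   Differentiating along a tangent vector q requires a curve of polygons with
   velocity q. All sides but one move along conics of their hyperboloids, the
   remaining side b closes the polygon, and b together with a side c not collinear
   with it is then corrected by s and - s, with s in their plane: this amounts to
   one quadratic equation, and s has zero velocity. *)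

(** * Differentiation of matrices, of the form and of the bracket *)

Section MatrixCalculus.
Context {R : realType} {V : normedModType R}.
Implicit Types (x v : V).

Lemma is_derive_mxP m n (M : V -> 'M[R]_(m, n)) x v dM :
  is_derive x v M dM <->
  forall i j, is_derive x v (fun y => M y i j) (dM i j).
Proof.
split=> [dMx i j|dMx].
  have dx : derivable M x v by [].
  apply: DeriveDef; first exact: (derivable_mxP M x v).1.
  by rewrite -(@derive_val _ _ _ _ _ _ _ dMx) derive_mx // mxE.
have dx : derivable M x v by apply/derivable_mxP => i j; case: (dMx i j).
apply: DeriveDef => //; rewrite derive_mx //; apply/matrixP => i j.
by rewrite mxE; exact: (@derive_val _ _ _ _ _ _ _ (dMx i j)).
Qed.

Lemma differentiable_mx m n (M : V -> 'M[R]_(m, n)) x :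
  (forall i j, differentiable (fun y => M y i j) x) -> differentiable M x.
Proof.
move=> dM.
have -> : M = \sum_i \sum_j (fun y => M y i j *: delta_mx i j).
  apply/funext => y; rewrite [LHS]matrix_sum_delta fct_sumE.
  by apply: eq_bigr => i _; rewrite fct_sumE.
apply: differentiable_sum => i; apply: differentiable_sum => j.
exact: differentiableZl.
Qed.

Lemma is_deriveMf (f g : V -> R) x v (df dg : R) :
  is_derive x v f df -> is_derive x v g dg ->
  is_derive x v (fun y => f y * g y) (df * g x + f x * dg).
Proof.
move=> hf hg; apply: (@is_derive_eq _ _ _ (f * g)).
by rewrite addrC mulrC.
Qed.


Lemma is_deriveZf m n (k : V -> R) (M : V -> 'M[R]_(m, n)) x v dk dM :
  is_derive x v k dk -> is_derive x v M dM ->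
  is_derive x v (fun y => k y *: M y) (dk *: M x + k x *: dM).
Proof.
move=> hk /is_derive_mxP hM; apply/is_derive_mxP => i j; rewrite !mxE.
under eq_fun do rewrite mxE.
exact: is_deriveMf.
Qed.

Lemma is_derive_row m n (M : V -> 'M[R]_(m, n)) x v dM a :
  is_derive x v M dM -> is_derive x v (fun y => row a (M y)) (row a dM).
Proof.
move=> /is_derive_mxP hM; apply/is_derive_mxP => i j; rewrite !mxE.
under eq_fun do rewrite mxE.
exact: hM.
Qed.

Lemma is_derive_rowP m n
    (M : V -> 'M[R]_(m, n)) x v dM :
  (forall a, is_derive x v (fun y => row a (M y)) (row a dM)) ->
  is_derive x v M dM.
Proof.
move=> h; apply/is_derive_mxP => i j.
have /is_derive_mxP/(_ ord0 j) := h i; rewrite mxE.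
by under eq_fun do rewrite mxE.
Qed.

Lemma is_derive_mform (f g : V -> 'rV[R]_3) x v df dg :
  is_derive x v f df -> is_derive x v g dg ->
  is_derive x v (fun y => mform (f y) (g y)) (mform df (g x) + mform (f x) dg).
Proof.
move=> /is_derive_mxP hf /is_derive_mxP hg; rewrite /mform.
have h j := is_deriveMf (hf ord0 j) (hg ord0 j).
have H := is_deriveB (is_deriveB (h i2) (h i0)) (h i1).
by apply: (@is_derive_eq _ _ _ _ _ _ _ _ H); ring.
Qed.

Lemma is_derive_bracket (f g : V -> 'rV[R]_3) x v df dg :
  is_derive x v f df -> is_derive x v g dg ->
  is_derive x v (fun y => bracket (f y) (g y))
    (bracket df (g x) + bracket (f x) dg).
Proof.
move=> /is_derive_mxP hf /is_derive_mxP hg; apply/is_derive_mxP => i j.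
have h a b := is_deriveMf (hf ord0 a) (hg ord0 b).
have H a b c d := is_deriveB (h a b) (h c d).
under eq_fun do rewrite bracketE mxE.
rewrite mxE !bracketE !mxE; case: (j == i0); case: (j == i1).
- by apply: (@is_derive_eq _ _ _ _ _ _ _ _ (H i2 i1 i1 i2)); ring.
- by apply: (@is_derive_eq _ _ _ _ _ _ _ _ (H i2 i1 i1 i2)); ring.
- by apply: (@is_derive_eq _ _ _ _ _ _ _ _ (H i0 i2 i2 i0)); ring.
- by apply: (@is_derive_eq _ _ _ _ _ _ _ _ (H i0 i1 i1 i0)); ring.
Qed.

Lemma is_derive_big (I : Type) (r : seq I) (Q : pred I) (W : normedModType R)
    (h : I -> V -> W) x v (dh : I -> W) :
  (forall i, Q i -> is_derive x v (h i) (dh i)) ->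
  is_derive x v (fun y => \sum_(i <- r | Q i) h i y) (\sum_(i <- r | Q i) dh i).
Proof.
move=> H; elim: r => [|i r IH].
  rewrite big_nil; under eq_fun do rewrite big_nil; exact: is_derive_cst.
rewrite big_cons; under eq_fun do rewrite big_cons.
case: ifP => // Qi; exact: is_deriveD (H i Qi) IH.
Qed.

End MatrixCalculus.

(** * Derivatives along curves *)

Section CurveCalculus.
Context {R : realType}.

Lemma is_derive_comp_curve (V W : normedModType R) (F : V -> W) (g : R -> V) (t : R) q :
  differentiable F (g t) -> is_derive t 1 g q ->
  is_derive t 1 (F \o g) ('d F (g t) q).
Proof.
move=> dF dg; have /derivable1_diffP dg' : derivable g t 1 by [].
have dc := differentiable_comp dg' dF.
apply: DeriveDef; first exact/derivable1_diffP.
have dgt : 'd g t 1 = q.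
  by rewrite -(deriveE _ dg') (@derive_val _ _ _ _ _ _ _ dg).
by rewrite deriveE // diff_comp //= dgt.
Qed.

(** The curves built below are polygons only near time 0; this local form suffices to differentiate
    identities along them. *)
Lemma derive_near0 (W : normedModType R) (F : R -> W) (t : R) d :
  is_derive t 1 F d -> (\forall u \near t, F u = 0) -> d = 0.
Proof.
move=> dF F0; have d0 : is_derive t 1 (cst 0 : R -> W) d.
  exact: near_eq_is_derive dF.
by rewrite -(@derive_val _ _ _ _ _ _ _ d0) derive_cst.
Qed.

Lemma derivable_near_lt0 (f : R -> R) (t : R) :
  derivable f t 1 -> f t < 0 -> \forall u \near t, f u < 0.
Proof.
move=> /derivable1_diffP/differentiable_continuous cf ft.
exact: (cvgr_lt _ cf).
Qed.

End CurveCalculus.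

(** * Bilinearity and Gram determinants *)

Section MinkowskiForm.
Context {R : realType}.
Implicit Types u v w p q : 'rV[R]_3.

Lemma mformDl u v w : mform (u + v) w = mform u w + mform v w.
Proof. by rewrite /mform !mxE; ring. Qed.

Lemma mformDr u v w : mform w (u + v) = mform w u + mform w v.
Proof. by rewrite mformC mformDl !(mformC w). Qed.

Lemma mformZr k u v : mform u (k *: v) = k * mform u v.
Proof. by rewrite mformC mformZl mformC. Qed.

Lemma mform_lincomb u v (x y : R) :
  mform (x *: u + y *: v) (x *: u + y *: v) =
  x ^+ 2 * mform u u + 2 * (x * y * mform u v) + y ^+ 2 * mform v v.
Proof. by rewrite !(mformDl, mformDr, mformZl, mformZr) (mformC v u); ring. Qed.

Definition gram u v : R := mform u u * mform v v - mform u v ^+ 2.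

(** The Gram determinant is the square of [bracket u v], which is orthogonal to the time-like [u]
    and hence space-like unless it vanishes. *)
Lemma gram_lt0 u v : 0 < mform u u -> bracket u v != 0 -> gram u v < 0.
Proof.
move=> uu uv; have -> : gram u v = mform (bracket u v) (bracket u v).
  by rewrite /gram !bracketE /mform !mxE /=; ring.
have uvu : mform (bracket u v) u = 0.
  by rewrite bracketC -scaleN1r mformZl mform_bracketl mulr0.
have [le0 eq0] := timelike_orthogonal uu uvu.
by rewrite lt_neqAle le0 andbT; apply: contra uv => /eqP/eq0/eqP.
Qed.

End MinkowskiForm.

(** * Curves on a hyperboloid *)

Section HyperboloidArc.
Context {R : realType}.
Implicit Types p q : 'rV[R]_3.

(* The conic section of the hyperboloid through p by the plane of p and q,
   rationally parametrised with velocity q at p. *)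
Definition conic_arc p q (t : R) : 'rV[R]_3 :=
  let nu := mform q q / (4 * mform p p) in
  (1 + nu * t ^+ 2)^-1 *: ((1 - nu * t ^+ 2) *: p + t *: q).

Lemma conic_arc0 p q : conic_arc p q 0 = p.
Proof.
by rewrite /conic_arc expr0n /= !mulr0 addr0 subr0 invr1 !scale1r scale0r addr0.
Qed.

(** As (p, q) = 0 and (q, q) = 4 nu (p, p), the numerator has square ((1 - nu t^2)^2 + 4 nu t^2) (p,
    p) = (1 + nu t^2)^2 (p, p). *)
Lemma mform_conic_arc p q t : mform p p != 0 -> mform q p = 0 ->
  1 + mform q q / (4 * mform p p) * t ^+ 2 != 0 ->
  mform (conic_arc p q t) (conic_arc p q t) = mform p p.
Proof.
move=> pp qp nz; rewrite /conic_arc mformZl mformZr mform_lincomb (mformC p) qp.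
set nu := _ / _ in nz *; have -> : mform q q = 4 * nu * mform p p.
  by rewrite /nu; field.
by field.
Qed.

Lemma is_derive_conic_arc p q : is_derive (0 : R) 1 (conic_arc p q) q.
Proof.
rewrite /conic_arc; set nu := _ / _.
have sq k : is_derive (0 : R) 1 (fun t => 1 + k * t ^+ 2) (0 : R).
  have /= H := is_deriveMf (is_derive_id (0 : R) (1 : R)) (is_derive_id (0 : R) (1 : R)).
  have /= H' := is_deriveD (is_derive_cst (1 : R) (0 : R) (1 : R))
    (is_deriveMf (is_derive_cst k (0 : R) (1 : R)) H).
  by apply: (@is_derive_eq _ _ _ _ _ _ _ _ H'); rewrite /=; ring.
have sqN : is_derive (0 : R) 1 (fun t => 1 - nu * t ^+ 2) (0 : R).
  by under eq_fun do rewrite -mulNr; exact: sq.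
have n1 : 1 + nu * 0 ^+ 2 != 0 :> R by rewrite expr0n mulr0 addr0 oner_eq0.
have sqV : is_derive (0 : R) 1 (fun t => (1 + nu * t ^+ 2)^-1) (0 : R).
  have dv := sq nu; apply: DeriveDef; first exact: derivableV.
  by rewrite deriveV // derive_val scaler0.
have /= H := is_deriveZf sqV (is_deriveD (is_deriveZf sqN (is_derive_cst p (0 : R) (1 : R)))
   (is_deriveZf (is_derive_id (0 : R) (1 : R)) (is_derive_cst q (0 : R) (1 : R)))).
apply: (@is_derive_eq _ _ _ _ _ _ _ _ H) => /=.
by rewrite expr0n /= mulr0 addr0 subr0 invr1 !scale0r !scaler0 !add0r addr0 !scale1r.
Qed.

Lemma near_conic_arc p q : \forall t \near (0 : R),
  1 + mform q q / (4 * mform p p) * t ^+ 2 != 0.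
Proof.
set nu := _ / _.
have : \forall t \near (0 : R), - (1 + nu * t ^+ 2) < 0.
  apply: derivable_near_lt0; last by rewrite expr0n mulr0 addr0 oppr_lt0.
  by apply: derivableN; apply: derivableD => //; apply: derivableM => //; exact: derivableX.
by apply: filterS => t; rewrite oppr_lt0 => /gt_eqF ->.
Qed.

End HyperboloidArc.

(** * Correcting the lengths of two sides while keeping their sum *)

Section TwoSides.
Context {R : realType}.
Implicit Types mu M g h : R.

(* Two sides u, v with Gram matrix (mu, g, h) are replaced by
   u + al *: u + be *: v and v - al *: u - be *: v, of squares mu and M. Half the square
   of the correction solves a quadratic equation; its small root is
   excess * root_ratio, written so that the leading coefficient may vanish. *)
Definition excess M h := (M - h) / 2.
Definition halfb mu M g h := g ^+ 2 - mu * h - excess M h * (g + mu).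
Definition discr mu M g h :=
  halfb mu M g h ^+ 2 - (mu + 2 * g + h) * mu * excess M h ^+ 2.
Definition root_ratio mu M g h :=
  - (mu * excess M h) / (halfb mu M g h + Num.sqrt (discr mu M g h)).
Definition al_ratio mu M g h :=
  let sg := root_ratio mu M g h in (- sg * h - (sg - 1) * g) / (mu * h - g ^+ 2).
Definition be_ratio mu M g h :=
  let sg := root_ratio mu M g h in (mu * (sg - 1) + sg * g) / (mu * h - g ^+ 2).

(** For s = al u + be v of square 2 e sg, with e the excess, the two length conditions read (s, u) =
    - e sg and (s, v) = e (sg - 1). Cramer's rule for the Gram matrix gives al and be; that s has
    square 2 e sg then follows from the quadratic equation for sg. *)
Lemma two_sides mu M g h :
  let al := excess M h * al_ratio mu M g h in
  let be := excess M h * be_ratio mu M g h in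
  mu * h - g ^+ 2 != 0 -> 0 <= discr mu M g h ->
  halfb mu M g h + Num.sqrt (discr mu M g h) != 0 ->
  (1 + al) ^+ 2 * mu + 2 * ((1 + al) * be * g) + be ^+ 2 * h = mu /\
  (- al) ^+ 2 * mu + 2 * ((- al) * (1 - be) * g) + (1 - be) ^+ 2 * h = M.
Proof.
rewrite /al_ratio /be_ratio /= => D0 disc0 den0.
set sg := root_ratio _ _ _ _.
set e := excess M h; have ME : M = h + 2 * e by rewrite /e /excess; field.
have quad : (mu + 2 * g + h) * (e * sg ^+ 2) + 2 * sg * halfb mu M g h + mu * e = 0.
  rewrite /sg /root_ratio -/e.
  move: den0 (sqr_sqrtr disc0); rewrite /discr -/e; set r := Num.sqrt _.
  (* Multiplied by the squared denominator of [sg], the left-hand side has r^2 - [discr] as a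
     factor. *)
  set k := halfb _ _ _ _ => den0 r2; apply: (mulfI (expf_neq0 2 den0)).
  transitivity (mu * e * ((mu + 2 * g + h) * mu * e ^+ 2 + r ^+ 2 - k ^+ 2)).
    by field.
  by rewrite r2; ring.
pose D := mu * h - g ^+ 2; rewrite -/D in D0 *.
set al := e * _; set be := e * _.
have e1 : al * mu + be * g = - (e * sg) by rewrite /al /be /D in D0 *; field.
have e2 : al * g + be * h = e * (sg - 1) by rewrite /al /be /D in D0 *; field.
have e3 : al ^+ 2 * mu + 2 * (al * be * g) + be ^+ 2 * h = 2 * (e * sg).
  have -> : al ^+ 2 * mu + 2 * (al * be * g) + be ^+ 2 * h =
    al * (al * mu + be * g) + be * (al * g + be * h) by ring.
  rewrite e1 e2 /al /be; apply: (mulIf D0).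
  transitivity (e * (e * sg ^+ 2 * (mu + 2 * g + h) - 2 * e * sg * (mu + g) + mu * e)).
    by rewrite /D in D0 *; field.
  transitivity (e * (((mu + 2 * g + h) * (e * sg ^+ 2) + 2 * sg * halfb mu M g h + mu * e)
     - 2 * sg * (halfb mu M g h + e * (g + mu)))); first by ring.
  by rewrite quad /halfb -/e /D; ring.
split.
- transitivity (mu + 2 * (al * mu + be * g) +
    (al ^+ 2 * mu + 2 * (al * be * g) + be ^+ 2 * h)); first by ring.
  by rewrite e1 e3; ring.
- transitivity (al ^+ 2 * mu + 2 * (al * be * g) + be ^+ 2 * h
    - 2 * (al * g + be * h) + h); first by ring.
  by rewrite e2 e3 ME; ring.
Qed.

(** * Differentiability of the correction at time 0 *)

Context (mu M : R) (g h : R -> R) (g' : R).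
Context (hg : is_derive (0 : R) 1 g g') (hh : is_derive (0 : R) 1 h (0 : R)).
Context (h0 : h 0 = M) (gram0 : mu * M - g 0 ^+ 2 < 0).

Let e0 : excess M (h 0) = 0.
Proof. by rewrite /excess h0 subrr mul0r. Qed.

Let halfb0 : halfb mu M (g 0) (h 0) = g 0 ^+ 2 - mu * M.
Proof. by rewrite /halfb e0 mul0r subr0 h0. Qed.

Let discr0 : discr mu M (g 0) (h 0) = (g 0 ^+ 2 - mu * M) ^+ 2.
Proof. by rewrite /discr e0 expr0n mulr0 subr0 halfb0. Qed.

Let halfb_gt0 : 0 < g 0 ^+ 2 - mu * M.
Proof. by rewrite -oppr_lt0 opprB. Qed.

Let is_derive_excess : is_derive (0 : R) 1 (fun t => excess M (h t)) (0 : R).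
Proof.
rewrite /excess.
have /= H := is_deriveMf (is_deriveB (is_derive_cst M (0 : R) (1 : R)) hh)
  (is_derive_cst (2^-1 : R) (0 : R) (1 : R)).
by apply: (@is_derive_eq _ _ _ _ _ _ _ _ H) => /=; ring.
Qed.

Local Notation drv u := (derivable u (0 : R) (1 : R)).
Let dC (k : R) : drv (fun=> k). Proof. exact: derivable_cst. Qed.
Let dD (u v : R -> R) : drv u -> drv v -> drv (fun t => u t + v t).
Proof. exact: derivableD. Qed.
Let dN (u : R -> R) : drv u -> drv (fun t => - u t).
Proof. exact: derivableN. Qed.
Let dB (u v : R -> R) : drv u -> drv v -> drv (fun t => u t - v t).
Proof. exact: derivableB. Qed.
Let dM (u v : R -> R) : drv u -> drv v -> drv (fun t => u t * v t).
Proof. exact: derivableM. Qed.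
Let dX (u : R -> R) : drv u -> drv (fun t => u t ^+ 2).
Proof. by move=> du; exact: dM. Qed.
Let dV (u : R -> R) : drv u -> u 0 != 0 -> drv (fun t => (u t)^-1).
Proof. by move=> du u0; exact: derivableV. Qed.
Let dg : derivable g (0 : R) (1 : R). Proof. by case: hg. Qed.
Let dh : derivable h (0 : R) (1 : R). Proof. by case: hh. Qed.
Let de : derivable (fun t => excess M (h t)) (0 : R) (1 : R).
Proof. by case: is_derive_excess. Qed.

Let derivable_gram : derivable (fun t => mu * h t - g t ^+ 2) 0 1.
Proof.
exact: (dB (dM (@dC mu) dh) (dX dg)).
Qed.

Let derivable_halfb : derivable (fun t => halfb mu M (g t) (h t)) 0 1.
Proof.
exact: (dB (dB (dX dg) (dM (@dC mu) dh)) (dM de (dD dg (@dC mu)))).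
Qed.

Let derivable_discr : derivable (fun t => discr mu M (g t) (h t)) 0 1.
Proof.
exact: (dB (dX derivable_halfb)
  (dM (dM (dD (dD (@dC mu) (dM (@dC 2) dg)) dh) (@dC mu)) (dX de))).
Qed.

(** The discriminant starts at the square of the positive number g(0)^2 - mu M, so its square root
    is differentiable at 0. *)
Let derivable_den :
  derivable (fun t => halfb mu M (g t) (h t) + Num.sqrt (discr mu M (g t) (h t))) 0 1.
Proof.
apply: (dD derivable_halfb); apply/derivable1_diffP.
apply: (@differentiable_comp _ _ _ _ _ Num.sqrt); first exact/derivable1_diffP.
apply/derivable1_diffP; rewrite discr0.
by case: (is_derive1_sqrt (exprn_gt0 2 halfb_gt0)) => d _; exact: d.
Qed.

Let den0 : 0 < halfb mu M (g 0) (h 0) + Num.sqrt (discr mu M (g 0) (h 0)).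
Proof. by rewrite ltr_wpDr ?sqrtr_ge0 // halfb0. Qed.

Let derivable_root : derivable (fun t => root_ratio mu M (g t) (h t)) 0 1.
Proof.
apply: (dM (dN (dM (@dC mu) de))); apply: (dV derivable_den).
by rewrite gt_eqF.
Qed.

Let gram_neq0 : mu * h 0 - g 0 ^+ 2 != 0.
Proof. by rewrite h0 lt_eqF. Qed.

(** The excess vanishes at 0 together with its derivative, so the product has derivative 0 as soon
    as the other factor is differentiable. *)
Lemma is_derive_al :
  is_derive (0 : R) 1 (fun t => excess M (h t) * al_ratio mu M (g t) (h t)) (0 : R).
Proof.
have /derivableP d : derivable (fun t => al_ratio mu M (g t) (h t)) 0 1.
  apply: (dM _ (dV derivable_gram gram_neq0)).
  exact: (dB (dM (dN derivable_root) dh) (dM (dB derivable_root (@dC 1)) dg)).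
apply: (@is_derive_eq _ _ _ _ _ _ _ _ (is_deriveMf is_derive_excess d)).
by rewrite e0 !mul0r addr0.
Qed.

Lemma is_derive_be :
  is_derive (0 : R) 1 (fun t => excess M (h t) * be_ratio mu M (g t) (h t)) (0 : R).
Proof.
have /derivableP d : derivable (fun t => be_ratio mu M (g t) (h t)) 0 1.
  apply: (dM _ (dV derivable_gram gram_neq0)).
  exact: (dD (dM (@dC mu) (dB derivable_root (@dC 1))) (dM derivable_root dg)).
apply: (@is_derive_eq _ _ _ _ _ _ _ _ (is_deriveMf is_derive_excess d)).
by rewrite e0 !mul0r addr0.
Qed.

(** The hypotheses of [two_sides] persist near 0, each being a strict inequality at 0. *)
Lemma near_two_sides : \forall t \near (0 : R),
  [/\ mu * h t - g t ^+ 2 != 0, 0 <= discr mu M (g t) (h t) &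
  halfb mu M (g t) (h t) + Num.sqrt (discr mu M (g t) (h t)) != 0].
Proof.
have n1 : \forall t \near (0 : R), mu * h t - g t ^+ 2 < 0.
  by apply: (derivable_near_lt0 derivable_gram); rewrite h0.
have n2 : \forall t \near (0 : R), - discr mu M (g t) (h t) < 0.
  by apply: (derivable_near_lt0 (dN derivable_discr)); rewrite discr0 oppr_lt0 exprn_gt0.
have n3 : \forall t \near (0 : R),
    - (halfb mu M (g t) (h t) + Num.sqrt (discr mu M (g t) (h t))) < 0.
  by apply: (derivable_near_lt0 (dN derivable_den)); rewrite oppr_lt0.
near=> t; split; first by rewrite lt_eqF //; near: t.
- by apply: ltW; rewrite -oppr_lt0; near: t.
- by rewrite gt_eqF // -oppr_lt0; near: t.
Unshelve. all: by end_near. Qed.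

End TwoSides.

(** * Curves of polygons with prescribed velocity *)

Section PolygonCurve.
Context {R : realType} {n : nat} (m : 'I_n -> R) (m_gt0 : forall a, 0 < m a).
Context (P q : 'M[R]_(n, 3)).
Context (MP : Mstar m P) (Tq : tangent P q).

Let PP a : mform (row a P) (row a P) = m a ^+ 2. Proof. exact: MP.1.2. Qed.
Let PP_gt0 a : 0 < mform (row a P) (row a P). Proof. by rewrite PP exprn_gt0. Qed.

(** If all brackets vanished, every side would be a multiple of one fixed side, which is nonzero
    because it is time-like. *)
Lemma noncollinear_pair : exists c b, bracket (row c P) (row b P) != 0.
Proof.
apply: contrapT => no; apply: MP.2.
have [c _|n0] := pickP (fun c : 'I_n => true); last by exists 0 => a; have := n0 a.
exists (row c P) => b; apply: bracket_eq0.
  by apply: contraTneq (PP_gt0 c) => ->; rewrite /mform !mxE !mul0r !subr0 ltxx.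
by apply/eqP/negPn/negP => cb; apply: no; exists c, b.
Qed.

(** Used contrapositively: a nonzero Gram determinant of two sides certifies non-collinearity. *)
Lemma gram_collinear (Q : 'M[R]_(n, 3)) c b :
  collinear Q -> gram (row c Q) (row b Q) = 0.
Proof.
move=> [v Qv]; have [x ->] := Qv c; have [y ->] := Qv b.
by rewrite /gram !(mformZl, mformZr); ring.
Qed.

Section Sides.
Context (c b : 'I_n) (cb : bracket (row c P) (row b P) != 0).

Let c_neq_b : c != b.
Proof.
apply: contraNneq cb => ->; rewrite bracketE; apply/eqP.
by apply: row3P; rewrite !mxE /=; ring.
Qed.

(* Closed, with every side but side b of the right length. *)
Let H (t : R) : 'M[R]_(n, 3) :=
  \matrix_a (if a == b then - \sum_(a' | a' != b) conic_arc (row a' P) (row a' q) t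
             else conic_arc (row a P) (row a q) t).

Let H0 : H 0 = P.
Proof.
apply/row_matrixP => a; rewrite rowK; case: eqP => [->|_]; last exact: conic_arc0.
under eq_bigr => a' _ do rewrite conic_arc0.
by apply/eqP; rewrite eq_sym -addr_eq0; have /eqP := MP.1.1; rewrite (bigD1 b).
Qed.

Let is_derive_H : is_derive (0 : R) 1 H q.
Proof.
apply: is_derive_rowP => a; under eq_fun do rewrite rowK.
case: eqP => [->|_]; last exact: is_derive_conic_arc.
(* The closing side has the right velocity because the entries of [q] sum to zero. *)
have -> : row b q = - \sum_(a' | a' != b) row a' q.
  by apply/eqP; rewrite -addr_eq0; have /eqP := Tq.2; rewrite (bigD1 b).
by apply: is_deriveN; apply: is_derive_big => a' _; exact: is_derive_conic_arc.
Qed.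

Let sum_H t : \sum_a row a (H t) = 0.
Proof.
rewrite (bigD1 b) //= rowK eqxx; apply/eqP; rewrite addrC subr_eq0; apply/eqP.
by apply: eq_bigr => a /negbTE ab; rewrite rowK ab.
Qed.

(** Only these two entries of the Gram matrix of sides c and b vary: near 0, side c of [H] keeps its
    square m_c^2. *)
Let g t := mform (row c (H t)) (row b (H t)).
Let h t := mform (row b (H t)) (row b (H t)).
Let al t := excess (m b ^+ 2) (h t) * al_ratio (m c ^+ 2) (m b ^+ 2) (g t) (h t).
Let be t := excess (m b ^+ 2) (h t) * be_ratio (m c ^+ 2) (m b ^+ 2) (g t) (h t).
Let s t := al t *: row c (H t) + be t *: row b (H t).

Let curve t : 'M[R]_(n, 3) :=
  \matrix_a (row a (H t) + ((if a == c then s t else 0) + (if a == b then - s t else 0))).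

Let h0 : h 0 = m b ^+ 2. Proof. by rewrite /h H0 PP. Qed.

Let al0 : al 0 = 0. Proof. by rewrite /al h0 /excess subrr !mul0r. Qed.
Let be0 : be 0 = 0. Proof. by rewrite /be h0 /excess subrr !mul0r. Qed.

Let gram0 : m c ^+ 2 * m b ^+ 2 - g 0 ^+ 2 < 0.
Proof. by rewrite /g H0 -!PP; exact: gram_lt0. Qed.

Let is_derive_g := is_derive_mform (is_derive_row c is_derive_H) (is_derive_row b is_derive_H).

(** The derivative is 2 (q_b, p_b), zero by tangency; this is why the correction has zero
    velocity. *)
Let is_derive_h : is_derive (0 : R) 1 h (0 : R).
Proof.
apply: (@is_derive_eq _ _ _ _ _ _ _ _ (is_derive_mform (is_derive_row b is_derive_H)
  (is_derive_row b is_derive_H))).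
by rewrite H0 (mformC (row b P)) Tq.1 addr0.
Qed.

Let is_derive_s : is_derive (0 : R) 1 s (0 : 'rV[R]_3).
Proof.
have dal := is_derive_al is_derive_g is_derive_h h0 gram0.
have dbe := is_derive_be is_derive_g is_derive_h h0 gram0.
have /= D := is_deriveD (is_deriveZf dal (is_derive_row c is_derive_H))
  (is_deriveZf dbe (is_derive_row b is_derive_H)).
apply: (@is_derive_eq _ _ _ _ _ _ _ _ D).
by rewrite -/(al 0) -/(be 0) al0 be0 !scale0r !addr0.
Qed.

Let curve0 : curve 0 = P.
Proof.
apply/row_matrixP => a; rewrite rowK H0 /s al0 be0 !scale0r addr0 oppr0.
by rewrite !if_same !addr0.
Qed.

Let is_derive_curve : is_derive (0 : R) 1 curve q.
Proof.
apply: is_derive_rowP => a; under eq_fun do rewrite rowK.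
have z : is_derive (0 : R) 1 (fun=> 0 : 'rV[R]_3) 0 by exact: is_derive_cst.
have d1 : is_derive (0 : R) 1 (fun t => if a == c then s t else 0) 0 by case: (a == c).
have d2 : is_derive (0 : R) 1 (fun t => if a == b then - s t else 0) 0.
  case: (a == b) => //; exact: (is_derive_eq (is_deriveN is_derive_s) (oppr0 _)).
apply: (@is_derive_eq _ _ _ _ _ _ _ _
  (is_deriveD (is_derive_row a is_derive_H) (is_deriveD d1 d2))).
by rewrite !addr0.
Qed.

Let sum_curve t : \sum_a row a (curve t) = 0.
Proof.
under eq_bigr => a _ do rewrite rowK.
rewrite big_split /= sum_H add0r big_split /= -!big_mkcond !big_pred1_eq.
exact: subrr.
Qed.

Let curve_c t : row c (curve t) = (1 + al t) *: row c (H t) + be t *: row b (H t).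
Proof. by rewrite rowK eqxx (negbTE c_neq_b) addr0 scalerDl scale1r addrA. Qed.

Let curve_b t : row b (curve t) = (- al t) *: row c (H t) + (1 - be t) *: row b (H t).
Proof.
rewrite rowK eqxx eq_sym (negbTE c_neq_b) add0r scalerDl scale1r !scaleNr opprD.
by rewrite addrCA.
Qed.

Lemma polygon_curve_sides : exists G : R -> 'M[R]_(n, 3),
  [/\ G 0 = P, is_derive (0 : R) 1 G q & \forall t \near (0 : R), Mstar m (G t)].
Proof.
exists curve; split => //.
have n1 : \forall t \near (0 : R), forall a, a != b ->
    mform (row a (H t)) (row a (H t)) = m a ^+ 2.
  have N : \forall t \near (0 : R), forall a,
      1 + mform (row a q) (row a q) / (4 * mform (row a P) (row a P)) * t ^+ 2 != 0.
    by exact: filter_forall (fun a => near_conic_arc (row a P) (row a q)).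
  apply: filterS N => t nz a /negbTE ab; rewrite rowK ab mform_conic_arc ?PP //.
  - by rewrite -PP gt_eqF.
  - exact: Tq.1.
  - by rewrite -PP.
have n2 := near_two_sides is_derive_g is_derive_h h0 gram0.
(* Negativity of this Gram determinant at time 0 persists and keeps the polygons non-collinear. *)
have n3 : \forall t \near (0 : R), gram (row c (curve t)) (row b (curve t)) < 0.
  have dc := is_derive_row c is_derive_curve.
  have db := is_derive_row b is_derive_curve.
  have D := is_deriveB (is_deriveMf (is_derive_mform dc dc) (is_derive_mform db db))
    (is_deriveMf (is_derive_mform dc db) (is_derive_mform dc db)).
  apply: (@derivable_near_lt0 _ (fun t => gram (row c (curve t)) (row b (curve t)))).
    by rewrite /gram; under eq_fun do rewrite expr2; case: D.
  by rewrite curve0; exact: (gram_lt0 (PP_gt0 c) cb).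
near=> t; split; last first.
  move=> /(gram_collinear c b) G0.
  have : gram (row c (curve t)) (row b (curve t)) < 0 by near: t.
  by rewrite G0 ltxx.
split=> // a.
have Ht : forall a, a != b -> mform (row a (H t)) (row a (H t)) = m a ^+ 2.
  by near: t.
have [D0 disc_ge0 den_neq0] : [/\ m c ^+ 2 * h t - g t ^+ 2 != 0,
    0 <= discr (m c ^+ 2) (m b ^+ 2) (g t) (h t) &
    halfb (m c ^+ 2) (m b ^+ 2) (g t) (h t) +
    Num.sqrt (discr (m c ^+ 2) (m b ^+ 2) (g t) (h t)) != 0] by near: t.
have [Ec Eb] := two_sides D0 disc_ge0 den_neq0.
have [->|ac] := eqVneq a c.
  by rewrite curve_c mform_lincomb Ht.
have [->|ab] := eqVneq a b.
  by rewrite curve_b mform_lincomb Ht.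
by rewrite rowK (negbTE ac) (negbTE ab) !addr0 Ht.
Unshelve. all: by end_near. Qed.

End Sides.

Lemma polygon_curve : exists G : R -> 'M[R]_(n, 3),
  [/\ G 0 = P, is_derive (0 : R) 1 G q & \forall t \near (0 : R), Mstar m (G t)].
Proof.
by have [c [b cb]] := noncollinear_pair; exact: polygon_curve_sides cb.
Qed.

End PolygonCurve.

(** * Algebra of the Nijenhuis tensor, side by side and summed over the sides *)

Section RowIdentity.
Context {R : realType}.
Implicit Types u v p x y : 'rV[R]_3.

Lemma bracketNl u p : bracket (- u) p = - bracket u p.
Proof. by rewrite -scaleN1r bracketZl scaleN1r. Qed.

Lemma bracketZr k u p : bracket p (k *: u) = k *: bracket p u.
Proof. by rewrite bracketC bracketZl -scalerN -bracketC. Qed.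

(** For u orthogonal to p, division by (p, p) gives I^2 = -1. The first term is kept because
    derivatives of fields may have components along p. *)
Lemma bracket_bracketr u p :
  bracket (bracket u p) p = mform u p *: p - mform p p *: u.
Proof.
rewrite bracketC (bracketC u) -[- bracket p u]scaleN1r bracketZr scaleN1r opprK.
by rewrite bracketA mformC.
Qed.

(* One side of I([IX, Y] + [X, IY]) = [IX, IY] - [X, Y]; the vectors a1, a2, b1, b2 are
   the derivatives of X along Y and IY and those of Y along X and IX. *)
Lemma nijenhuis_row p x y a1 a2 b1 b2 (k : R) :
  k != 0 -> mform p p = k ^+ 2 -> mform x p = 0 -> mform y p = 0 ->
  mform a1 p = mform b1 p ->
  let j u v := k^-1 *: bracket u v in
  j ((b2 - (j a1 p + j x y)) + ((j b1 p + j y x) - a2)) p =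
  ((j b2 p + j y (j x p)) - (j a2 p + j x (j y p))) - (b1 - a1).
Proof.
move=> k0 pp xp yp ab; rewrite /=.
(* The bracket of two vectors orthogonal to p is a multiple of p, so a further bracket with p kills
   the terms from the derivative of I. What J^2 leaves along p cancels by [ab]. *)
have perp u v : mform u p = 0 -> mform v p = 0 -> bracket (bracket u v) p = 0.
  by move=> up vp; rewrite bracketC bracketA !(mformC p) up vp !scale0r subrr oppr0.
rewrite !(bracketDl, bracketNl, bracketZl, bracketZr, bracketA) !bracket_bracketr.
rewrite !perp // xp yp pp ab (mformC y x).
by apply/rowP => i; rewrite !mxE; field.
Qed.

(** Row a is [nijenhuis_row] with k = m_a. As [Iformula] takes the base point first, row a of
    [j y x] is [x_a, y_a] / m_a. *)
Lemma nijenhuis_tuple n (m : 'I_n -> R) (P x y a1 a2 b1 b2 : 'M[R]_(n, 3)) :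
  (forall a, m a != 0) -> (forall a, mform (row a P) (row a P) = m a ^+ 2) ->
  (forall a, mform (row a x) (row a P) = 0) ->
  (forall a, mform (row a y) (row a P) = 0) ->
  (forall a, mform (row a a1) (row a P) = mform (row a b1) (row a P)) ->
  let j := Iformula m in
  j P ((b2 - (j P a1 + j y x)) + ((j P b1 + j x y) - a2)) =
  ((j P b2 + j (j P x) y) - (j P a2 + j (j P y) x)) - (b1 - a1).
Proof.
move=> m0 PP xP yP ab j; apply/row_matrixP => a.
have rJ (u v : 'M[R]_(n, 3)) :
  row a (j u v) = (m a)^-1 *: bracket (row a v) (row a u) by exact: rowK.
have rD (u v : 'M[R]_(n, 3)) : row a (u + v) = row a u + row a v by exact: linearD.
have rB (u v : 'M[R]_(n, 3)) : row a (u - v) = row a u - row a v by exact: linearB.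
clearbody j; rewrite rJ rD 5!rB 4!rD !rJ.
exact: (nijenhuis_row (row a a2) (row a b2) (m0 a) (PP a) (xP a) (yP a) (ab a)).
Qed.

(** The hypotheses are the derivatives of the closing conditions of X along Y and of Y along X, and
    of the calibrations of X along IY and of Y along IX; [c] is the differentiated calibration
    sum. *)
Lemma sum_row_nijenhuis n (m : 'I_n -> R) (P x y ix iy a1 a2 b1 b2 : 'M[R]_(n, 3)) :
  let c a z iz := \sum_i (m i)^-1 *:
    (bracket (row i a) (row i P) + bracket (row i z) (row i iz)) in
  \sum_a row a a1 = 0 -> \sum_a row a b1 = 0 -> c a2 x iy = 0 -> c b2 y ix = 0 ->
  let j := Iformula m in
  \sum_a row a (((j P b2 + j ix y) - (j P a2 + j iy x)) - (b1 - a1)) = 0.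
Proof.
move=> c a10 b10 ca cb j.
have cE a z iz : c a z iz = \sum_i row i (j P a + j iz z).
  by apply: eq_bigr => i _; rewrite [RHS]linearD /= !rowK scalerDr.
rewrite !cE in ca cb; clearbody j c.
under eq_bigr do rewrite 3!linearB.
by rewrite !sumrB ca cb a10 b10 !subrr.
Qed.

End RowIdentity.

(** * Differentiating vector fields on the space of polygons *)

Section Fields.
Context {R : realType} {n : nat} (m : 'I_n -> R) (m_gt0 : forall a, 0 < m a).
Implicit Types (P q v : 'M[R]_(n, 3)) (U : set 'M[R]_(n, 3)).
Implicit Types (X Y : 'M[R]_(n, 3) -> 'M[R]_(n, 3)).

Lemma vector_field_differentiable U X P :
  vector_field m U X -> U P -> differentiable X P.
Proof. by move=> [sX _] UP; have [dX _] := sX 1%N; exact: dX. Qed.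

(** Tangency and calibration hold identically along a curve of polygons with velocity [q], on which
    [X] varies with velocity ['d X P q]; the product rule gives the three identities. *)
Lemma vector_field_constraints U X P q :
  open U -> vector_field m U X -> (U `&` Mstar m) P -> tangent P q ->
  let dX := 'd X P q in
  [/\ forall a, mform (row a dX) (row a P) + mform (row a (X P)) (row a q) = 0,
      \sum_a row a dX = 0 &
      \sum_a (m a)^-1 *: (bracket (row a dX) (row a P) +
                          bracket (row a (X P)) (row a q)) = 0].
Proof.
move=> oU VX [UP MP] Tq /=; have dX := vector_field_differentiable VX UP.
have [G [G0 dG MG]] := polygon_curve m_gt0 MP Tq; subst P.
have dXG := is_derive_comp_curve dX dG.
have UG : \forall t \near (0 : R), (U `&` Mstar m) (G t).
  have cG : {for (0 : R), continuous G}.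
    by apply/differentiable_continuous/derivable1_diffP; case: dG.
  have nU : nbhs (G 0) U by exact: open_nbhs_nbhs.
  by near=> t; split; near: t; [exact: (cG _ nU)|].
have row_dX a := is_derive_row a dXG; have row_dG a := is_derive_row a dG.
split=> [a||].
- apply: (derive_near0 (is_derive_mform (row_dX a) (row_dG a))).
  by apply: filterS UG => t /VX.2[[+ _] _ _].
- apply: (derive_near0 (is_derive_big (Q := xpredT) (index_enum _) (fun a _ => row_dX a))).
  by apply: filterS UG => t /VX.2[[_ +] _ _].
- have z a : is_derive (0 : R) 1 (fun=> (m a)^-1) (0 : R) by exact: is_derive_cst.
  have D a := is_deriveZf (z a) (is_derive_bracket (row_dX a) (row_dG a)).
  have E := is_derive_big (Q := xpredT) (index_enum _) (fun a _ => D a).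
  rewrite -[RHS](derive_near0 E); first by apply: eq_bigr => a _; rewrite scale0r add0r.
  by apply: filterS UG => t /VX.2[_ + _].
Unshelve. all: by end_near. Qed.

(** Product rule: [Iformula] is bilinear in base point and vector, and varying the base point puts
    [v] in its place. *)
Lemma diff_Ifield X P v : differentiable X P ->
  'd (Ifield m X) P v = Iformula m P ('d X P v) + Iformula m v (X P).
Proof.
move=> dX; have dXv : is_derive P v X ('d X P v).
  by rewrite -deriveE //; apply: derivableP; exact: diff_derivable.
have dI : differentiable (Ifield m X) P.
  apply: differentiable_mx => a j.
  have dXij k : differentiable (fun Q => X Q a k) P.
    exact: (differentiable_comp dX (differentiable_coord _ a k)).
  have dc (k : 'I_3) : differentiable (fun Q : 'M[R]_(n, 3) => Q a k) P.
    exact: differentiable_coord.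
  have dM k l := differentiableM (dXij k) (dc l).
  have dB k l k' l' := differentiableB (dM k l) (dM k' l').
  rewrite /Ifield /Iformula.
  under eq_fun do rewrite mxE mxE bracketE !mxE.
  apply: differentiableM => //.
  by case: (j == i0); [exact: dB|case: (j == i1); exact: dB].
suff D : is_derive P v (Ifield m X)
    (Iformula m P ('d X P v) + Iformula m v (X P)).
  exact: etrans (esym (deriveE v dI)) (@derive_val _ _ _ _ _ _ _ D).
apply: is_derive_rowP => a; under eq_fun do rewrite /Ifield rowK.
have z : is_derive P v (fun=> (m a)^-1) 0 by exact: is_derive_cst.
have D := is_deriveZf z (is_derive_bracket (is_derive_row a dXv)
   (is_derive_row a (is_derive_id P v))).
apply: (@is_derive_eq _ _ _ _ _ _ _ _ D).
by rewrite scale0r add0r scalerDr [RHS]linearD /= !rowK.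
Qed.

(** Calibrated representatives add up to a calibrated representative of the sum, and uniqueness
    identifies it. This merges the two middle terms of the Nijenhuis tensor. *)
Lemma IstructD P q w : Mstar m P ->
  Istruct m P q + Istruct m P w = Istruct m P (q + w).
Proof.
move=> MP; have calP z : same_class P z (calibrate m P z) /\ calibrated m P (calibrate m P z).
  exact: (xgetPex 0 (calibrated_exists m_gt0 z MP)).
have [[x qx] cq] := calP q; have [[y wy] cw] := calP w; have [sz cz] := calP (q + w).
have sD : same_class P (q + w) (calibrate m P q + calibrate m P w).
  exists (x + y) => a.
  by rewrite (linearD (row a)) /= qx wy (linearD (row a)) bracketDl addrACA.
have cD : calibrated m P (calibrate m P q + calibrate m P w).
  rewrite /calibrated; under eq_bigr => a _ do
    rewrite (linearD (row a)) /= bracketDl scalerDr.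
  rewrite big_split /=; exact: etrans (congr2 +%R cq cw) (addr0 _).
rewrite {3}/Istruct (calibrated_unique m_gt0 MP sz cz sD cD).
apply/row_matrixP => a; rewrite (linearD (row a)) /= !rowK -scalerDr -bracketDl.
by rewrite (linearD (row a)).
Qed.

End Fields.

(** * Vanishing of the Nijenhuis tensor *)

Theorem theorem2p6 (R : realType) (n : nat) (m : 'I_n -> R)
  (hn : (1 <= n)%N) (hm : forall a, 0 < m a) : I_integrable m.
Proof.
move=> U X Y [oU _] VX VY P UMP; have [UP MP] := UMP.
have dX := vector_field_differentiable VX UP.
have dY := vector_field_differentiable VY UP.
have [TX cX _] := VX.2 P UMP; have [TY cY _] := VY.2 P UMP.
have [TIX _] := Iformula_tangent hm MP TX cX.
have [TIY _] := Iformula_tangent hm MP TY cY.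
have [AY1 AY2 _] := vector_field_constraints hm oU VX UMP TY.
have [BX1 BX2 _] := vector_field_constraints hm oU VY UMP TX.
have [_ _ AJ] := vector_field_constraints hm oU VX UMP TIY.
have [_ _ BJ] := vector_field_constraints hm oU VY UMP TIX.
pose minus (u v : 'M[R]_(n, 3)) := u - v.
have lieII : lie (Ifield m X) (Ifield m Y) P =
    (Iformula m P ('d Y P (Ifield m X P)) + Iformula m (Ifield m X P) (Y P)) -
    (Iformula m P ('d X P (Ifield m Y P)) + Iformula m (Ifield m Y P) (X P)).
  exact: (congr2 minus (diff_Ifield m (Ifield m X P) dY)
    (diff_Ifield m (Ifield m Y P) dX)).
have lieI_ : lie (Ifield m X) Y P = 'd Y P (Ifield m X P) -
    (Iformula m P ('d X P (Y P)) + Iformula m (Y P) (X P)).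
  exact: (congr1 (minus ('d Y P (Ifield m X P))) (diff_Ifield m (Y P) dX)).
have lie_I : lie X (Ifield m Y) P =
    (Iformula m P ('d Y P (X P)) + Iformula m (X P) (Y P)) - 'd X P (Ifield m Y P).
  exact: (congr1 (minus^~ ('d X P (Ifield m Y P))) (diff_Ifield m (X P) dY)).
have key : Iformula m P (lie (Ifield m X) Y P + lie X (Ifield m Y) P) =
    lie (Ifield m X) (Ifield m Y) P - lie X Y P.
  rewrite lieII lieI_ lie_I /lie.
  apply: nijenhuis_tuple => a; [exact: lt0r_neq0|exact: MP.1.2|exact: TX.1|exact: TY.1|].
  (* Differentiating (X, p) = 0 along Y and (Y, p) = 0 along X shows that both products equal - (X,
     Y). *)
  apply: (addIr (mform (row a (X P)) (row a (Y P)))); rewrite AY1.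
  by rewrite (mformC (row a (X P))) BX1.
(* On a calibrated tuple [Istruct] is the plain formula, so [key] then makes the tensor cancel. *)
suff cal : calibrated m P (lie (Ifield m X) Y P + lie X (Ifield m Y) P).
  have -> : nijenhuis m X Y P = 0.
    rewrite /nijenhuis -[X in X - _]addrA -opprD IstructD //.
    by rewrite /Istruct calibrate_id // key opprB addrCA subrr addr0 subrr.
  by exists 0 => a; rewrite bracketE; apply: row3P; rewrite !mxE /=; ring.
(* The calibration sum of a tuple is the sum of the rows of its image under [Iformula], which [key]
   evaluates. *)
transitivity (\sum_a row a
    (Iformula m P (lie (Ifield m X) Y P + lie X (Ifield m Y) P))).
  by apply: eq_bigr => a _; rewrite rowK.
by rewrite key lieII; exact: sum_row_nijenhuis AY2 BX2 AJ BJ.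
Qed.
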